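(* Let $\ell\ge 2$, let $\mathcal A$ be a hyperplane arrangement in $\mathbb K^\ell$, let $H\in\mathcal A$ and $\mathcal A':=\mathcal A\setminus\{H\}$ (with $\mathcal A$ and $\mathcal A'$ essential). Put $r=r(\mathcal A)$, $r'=r(\mathcal A')$ and $r''=r(\mathcal A^H)$. If $r'<r''$, then $r=r'+1$.
   Context: $\mathbb K$ is a field of characteristic zero, $V=\mathbb K^\ell$, $S=\mathbb K[x_1,\dots,x_\ell]$ with the standard grading, and $\operatorname{Der} S=\bigoplus_{i=1}^\ell S\,\partial_{x_i}$, where $\sum a_i\partial_{x_i}$ is homogeneous of degree $e$ if all $a_i\in S_e$. A hyperplane arrangement $\mathcal A$ in $V$ is a finite set of (distinct) linear hyperplanes of $V$; it is essential if $\bigcap_{H\in\mathcal A}H=\{0\}$. For each $H\in\mathcal A$ fix a linear form $\alpha_H$ with $\ker\alpha_H=H$, and let $Q(\mathcal A)=\prod_{H\in\mathcal A}\alpha_H$. Let $D_0(\mathcal A)=\{\theta\in\operatorname{Der}S\mid \theta(Q(\mathcal A))=0\}$, a graded $S$-module, and $r(\mathcal A)=\min\{e\mid D_0(\mathcal A)_e\ne 0\}$ (with $\min\emptyset=+\infty$). For $H\in\mathcal A$ the restriction $\mathcal A^H=\{H\cap L\mid L\in\mathcal A\setminus\{H\}\}$ is an arrangement in the $(\ell-1)$-dimensional space $H$, and $r(\mathcal A^H)$ is computed over the polynomial ring $S/\alpha_HS$. *)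

(* Defs.v *)
From HB Require Import structures.
From mathcomp Require Import all_boot all_order all_algebra.
From mathcomp Require Import finmap mpoly.
From mathcomp Require Import boolp.

Set Implicit Arguments.
Unset Strict Implicit.
Unset Printing Implicit Defensive.

Import GRing.Theory.
Local Open Scope ring_scope.
Local Open Scope fset_scope.

Section ExtendedDegrees.

(* Elements of nat + {+oo}, with None playing the role of +oo. *)
Definition xnat := option nat.

Definition xnat_lt (m n : xnat) : bool :=
  match m, n with
  | Some a, Some b => (a < b)%N
  | Some _, None => true
  | None, _ => false
  end.

Definition xnat_succ (m : xnat) : xnat := omap succn m.

Definition xnat_min (P : nat -> Prop) : xnat :=
  match pselect (exists e, `[< P e >]) with
  | left exP => Some (ex_minn exP)
  | right _ => None
  end.

Lemma xnat_minP (P : nat -> Prop) (m : xnat) :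
  xnat_min P = m <->
  match m with
  | Some e => P e /\ (forall e', P e' -> (e <= e')%N)
  | None => forall e, ~ P e
  end.
Proof.
rewrite /xnat_min; case: pselect => [exP|nP].
- case: ex_minnP => e /asboolP Pe emin; case: m => [e'|]; split.
  + by case=> <-; split=> // k Pk; apply: emin; apply/asboolP.
  + case=> Pe' e'min; congr Some; apply/eqP.
    by rewrite eqn_leq e'min // emin //; apply/asboolP.
  + by [].
  + by move/(_ e).
- case: m => [e|]; split=> //.
  + by case=> Pe _; case: nP; exists e; apply/asboolP.
  + by move=> _ e Pe; apply: nP; exists e; apply/asboolP.
Qed.

End ExtendedDegrees.

Section Arrangements.

Variables (K : fieldType) (V : vectType K).

Definition is_arrangement (A : {fset {vspace V}}) : Prop :=
  forall H, H \in A -> (\dim H).+1 = \dim {:V}.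

Definition essential (A : {fset {vspace V}}) : Prop :=
  (\bigcap_(H <- A) H)%VS = 0%VS.

Definition defining_form (H : {vspace V}) : 'Hom(V, K^o) :=
  match pselect (exists f : 'Hom(V, K^o), lker f == H) with
  | left exf => xchoose exf
  | right _ => 0
  end.

Lemma lker_defining_form (H : {vspace V}) :
  (\dim H).+1 = \dim {:V} -> lker (defining_form H) = H.
Proof.
move=> dimH; rewrite /defining_form; case: pselect => [exf|[]].
  exact/eqP/(xchooseP exf).
have dimC : \dim H^C = 1%N by rewrite dimv_compl -dimH subSnn.
have C0 : (H^C :&: H = 0)%VS by rewrite capvC capv_compl.
set u := vpick H^C.
have u0 : u != 0 by rewrite vpick0 -dimv_eq0 dimC.
have spanu : <[u]>%VS = (H^C)%VS.
  by apply/eqP; rewrite eqEdim -memvE memv_pick dimC dim_vline u0.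
pose g : {linear V -> K^o} := coord [tuple u] ord0.
exists (linfun g \o daddv_pi (H^C) H)%VF.
apply/eqP/vspaceP => v; rewrite memv_ker comp_lfunE lfunE /=.
have vS : v \in (H^C + H)%VS by rewrite addvC addv_complf memvf.
have Dv := daddv_pi_add C0 vS.
apply/eqP/idP => [c0|vH].
- rewrite -Dv; suff -> : daddv_pi H^C H v = 0 by rewrite add0r memv_pi.
  have : daddv_pi H^C H v \in <<[tuple u]>>%VS by rewrite span_seq1 spanu memv_pi.
  by move/coord_span->; rewrite big_ord1 c0 scale0r.
- suff -> : daddv_pi H^C H v = 0 by rewrite linear0.
  have HC0 : (H :&: H^C = 0)%VS by rewrite capv_compl.
  by apply: (addIr v); rewrite add0r -[RHS]Dv (daddv_pi_id HC0 vH).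
Qed.

(* The intersections of H with the other members of A, seen as subspaces of
   the vector space H itself. *)
Definition restriction (A : {fset {vspace V}}) (H : {vspace V}) :
    {fset {vspace subvs_of H}} :=
  [fset (linfun (@vsval K V H) @^-1: L)%VS | L in A `\ H].

Section Coordinates.

(* A basis b of V identifies the ring of polynomial functions on V with
   {mpoly K[n]}, where 'X_i is the i-th coordinate function with respect to b;
   for V = H a hyperplane of K^l this ring is S / alpha_H S. *)
Variables (n : nat) (b : n.-tuple V).

Definition form_poly (f : 'Hom(V, K^o)) : {mpoly K[n]} :=
  \sum_(i < n) (f (tnth b i) : K) *: 'X_i.

Definition defining_poly (A : {fset {vspace V}}) : {mpoly K[n]} :=
  \prod_(H <- A) form_poly (defining_form H).

End Coordinates.

End Arrangements.

(* The family t stands for the derivation \sum_i t i * d/dx_i. *)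
Definition der_app (K : fieldType) (n : nat)
    (t : {ffun 'I_n -> {mpoly K[n]}}) (f : {mpoly K[n]}) : {mpoly K[n]} :=
  \sum_(i < n) t i * f^`M(i).

Definition der_homog (K : fieldType) (n e : nat)
    (t : {ffun 'I_n -> {mpoly K[n]}}) : Prop :=
  forall i, t i \is e.-homog.

Definition in_D0 (K : fieldType) (V : vectType K) (n : nat) (b : n.-tuple V)
    (A : {fset {vspace V}}) (t : {ffun 'I_n -> {mpoly K[n]}}) : Prop :=
  der_app t (defining_poly b A) = 0.

Definition min_deg_D0 (K : fieldType) (V : vectType K) (n : nat)
    (b : n.-tuple V) (A : {fset {vspace V}}) : xnat :=
  xnat_min (fun e => exists t : {ffun 'I_n -> {mpoly K[n]}},
    [/\ in_D0 b A t, der_homog e t & t != 0]).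

Definition std_basis (K : fieldType) (l : nat) : l.-tuple 'rV[K]_l :=
  [tuple delta_mx 0 i | i < l].

(* Main.v *)
Require Import Defs.
From HB Require Import structures.
From mathcomp Require Import all_boot all_order all_algebra.
From mathcomp Require Import finmap mpoly.

Set Implicit Arguments.
Unset Strict Implicit.
Unset Printing Implicit Defensive.

Import GRing.Theory.
Local Open Scope ring_scope.

(** Call a derivation logarithmic for [A] if it maps every defining form of [A]
    into the ideal generated by that form.  Derivations killing the defining
    polynomial [Q] are logarithmic, because the forms are prime and pairwise
    non-proportional.
    Conversely, if [t] is logarithmic then [t Q = g Q], and subtracting
    [(g / #|A|)] times the Euler derivation, for which [Q] is an eigenvector of
    eigenvalue [#|A|], makes [t] kill [Q]; this is where characteristic zero
    enters.  Hence a nonzero element of degree [e] in [D_0(A)] exists iff some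
    logarithmic derivation of degree [e] is not a multiple of the Euler
    derivation ([has_D0_of_log], [in_D0_log], [in_D0_not_euler]).

    From this criterion [r' <= r <= r' + 1]: derivations logarithmic for [A]
    are so for [A'], and [alpha_H] times a derivation logarithmic for [A'] is
    logarithmic for [A] ([has_D0_delete], [has_D0_succ]).  It remains to
    exclude [r = r'].  Let [t] be a nonzero element of [D_0(A)] of degree [e],
    and suppose that [D_0(A^H)] vanishes in degree [e].  As [t] preserves the
    ideal of [H], it restricts to [H], and the restriction is logarithmic for
    [A^H]; by the criterion it is a multiple of the Euler derivation of [H].
    Lifting the multiplier, [t = f E + alpha_H h] with [h] of degree [e - 1].
    Since [alpha_H] is prime to the other forms, [h] is logarithmic for [A'],
    and it is no multiple of [E] because [t] is none.  So [D_0(A')] is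
    nonzero in degree [e - 1] ([has_D0_descent]), which is impossible for
    [e = r']. *)

(** * Polynomials and linear forms *)

Section Polynomials.

Variables (K : fieldType) (n : nat).
Implicit Types p q x : {mpoly K[n]}.

(** Facts about ring morphisms out of a polynomial ring, such as substitutions,
    then only have to be checked on constants and variables. *)
Lemma mpoly_gen_ind (P : {mpoly K[n]} -> Prop) :
  (forall c, P c%:MP) -> (forall i, P 'X_i) ->
  (forall p q, P p -> P q -> P (p + q)) ->
  (forall p q, P p -> P q -> P (p * q)) -> forall p, P p.
Proof.
move=> PC PX PD PM; elim/mpolyind=> [|c m p _ _ Pp].
  by rewrite -mpolyC0; apply: (PC).
apply: (PD) => //; rewrite -mul_mpolyC; apply: (PM) => //.
rewrite mpolyXE_id; apply: (big_ind P) => [|p' q'|i _].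
- by rewrite -mpolyC1; apply: (PC).
- exact: (PM).
elim: (m i) => [|k IHk]; first by rewrite expr0 -mpolyC1; apply: (PC).
by rewrite exprS; apply: (PM).
Qed.

Lemma pihomog_mul_linear e p x : x \is 1.-homog ->
  pihomog mdeg e.+1 (p * x) = pihomog mdeg e p * x.
Proof.
move=> hx; elim/mpolyind: p => [|c m p _ _ IHp].
  by rewrite !(mul0r, raddf0).
rewrite mulrDl !raddfD /= IHp mulrDl; congr (_ + _).
rewrite -scalerAl !linearZ /= pihomogX -scalerAl; congr (_ *: _).
have hX : 'X_[m] * x \is (mdeg m + 1).-homog.
  by apply: dhomogM => //; rewrite dhomogX.
case: eqP => [<-|/eqP ne]; first by rewrite pihomog_dE // -addn1.
by rewrite mul0r (pihomog_ne0 _ hX) // addn1 eqSS.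
Qed.

Lemma pihomog0_mul_linear p x : x \is 1.-homog ->
  pihomog mdeg 0 (p * x) = 0.
Proof.
move=> hx; elim/mpolyind: p => [|c m p _ _ IHp].
  by rewrite !(mul0r, raddf0).
rewrite mulrDl !raddfD /= IHp addr0 -scalerAl linearZ /=.
have hX : 'X_[m] * x \is (mdeg m + 1).-homog.
  by apply: dhomogM => //; rewrite dhomogX.
by rewrite (pihomog_ne0 _ hX) ?scaler0 // addn1.
Qed.

Definition divides p q := exists g, q = g * p.

Definition lform (a : 'I_n -> K) : {mpoly K[n]} := \sum_i a i *: 'X_i.

Lemma lform_homog a : lform a \is 1.-homog.
Proof.
by apply: rpred_sum => i _; apply: rpredZ; rewrite dhomogX /= mdeg1.
Qed.

Lemma lform_meval a (v : 'I_n -> K) : (lform a).@[v] = \sum_i a i * v i.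
Proof.
by rewrite raddf_sum; apply: eq_bigr => i _; rewrite /= mevalZ mevalXU.
Qed.

End Polynomials.

Section Substitution.

Variables (K : fieldType) (n k : nat).

(** The polynomial map given by [h], as a ring morphism on polynomials; the
    variables are indexed by a function because the linear changes of
    coordinates below are given by coefficient functions. *)
Definition subst (h : 'I_n -> {mpoly K[k]}) : {mpoly K[n]} -> {mpoly K[k]} :=
  mmap (@mpolyC k K) h.

HB.instance Definition _ h := GRing.RMorphism.on (subst h).

Lemma substC h c : subst h c%:MP = c%:MP.
Proof. exact: mmapC. Qed.

Lemma substX h i : subst h 'X_i = h i.
Proof. by rewrite /subst mmapX mmap1U. Qed.

Lemma substZ h c p : subst h (c *: p) = c *: subst h p.
Proof. by rewrite /subst mmapZ mul_mpolyC. Qed.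

Lemma subst_lform h a : subst h (lform a) = \sum_i a i *: h i.
Proof.
by rewrite raddf_sum; apply: eq_bigr => i _; rewrite /= substZ substX.
Qed.

End Substitution.

(** * Primality of linear forms *)

Section LinearFormPrime.

Variables (K : fieldType) (n : nat) (a v : 'I_n -> K).
Hypothesis av1 : \sum_i a i * v i = 1.

(** Composition with the projection of the space onto the hyperplane [a = 0]
    along the vector [v].  Since [a v = 1], its kernel is the ideal generated by
    the form [a], which is therefore the kernel of a morphism to a domain. *)
Definition proj_along : {mpoly K[n]} -> {mpoly K[n]} :=
  subst (fun k => 'X_k - v k *: lform a).

HB.instance Definition _ := GRing.RMorphism.on proj_along.

Lemma proj_along_lform c :
  proj_along (lform c) = lform c - (\sum_k c k * v k) *: lform a.
Proof.
rewrite [LHS]subst_lform scaler_suml -sumrB.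
by apply: eq_bigr => k _; rewrite scalerBr scalerA.
Qed.

(** The projection is the identity modulo the form [a] on the variables, hence on
    all polynomials. *)
Lemma divides_sub_proj p : divides (lform a) (p - proj_along p).
Proof.
elim/mpoly_gen_ind: p => [c|i|p q [g Dp] [h Dq]|p q [g Dp] [h Dq]].
- by exists 0; rewrite mul0r [proj_along _]substC subrr.
- exists (v i)%:MP.
  by rewrite [proj_along _]substX opprB addrC subrK mul_mpolyC.
- by exists (g + h); rewrite rmorphD /= opprD addrACA Dp Dq mulrDl.
- exists (g * q + proj_along p * h).
  rewrite rmorphM /= mulrDl mulrAC -Dp -mulrA -Dq mulrBl mulrBr addrA.
  by rewrite subrK.
Qed.

Lemma divides_lformP p : divides (lform a) p <-> proj_along p = 0.
Proof.
split=> [[g ->]|p0]; last first.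
  by have := divides_sub_proj p; rewrite p0 subr0.
by rewrite rmorphM /= proj_along_lform av1 scale1r subrr mulr0.
Qed.

Lemma lform_prime p q : divides (lform a) (p * q) ->
  divides (lform a) p \/ divides (lform a) q.
Proof.
rewrite !divides_lformP rmorphM /= => /eqP.
by rewrite mulf_eq0 => /orP[] /eqP; [left|right].
Qed.

Lemma lform_neq0 : lform a != 0.
Proof.
apply/eqP => a0; have := lform_meval a v; rewrite a0 raddf0 av1.
by move/esym/eqP; rewrite oner_eq0.
Qed.

End LinearFormPrime.

(** * Logarithmic derivations *)

Section Derivations.

Variables (K : fieldType) (n : nat).
Implicit Types (t : {ffun 'I_n -> {mpoly K[n]}}) (p q g f : {mpoly K[n]}).

Definition der_scale g t : {ffun 'I_n -> {mpoly K[n]}} := [ffun i => g * t i].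

Definition euler : {ffun 'I_n -> {mpoly K[n]}} := [ffun i => 'X_i].

Definition euler_multiple t := exists f, t = der_scale f euler.

Definition log_der t p := divides p (der_app t p).

Lemma der_app1 t : der_app t 1 = 0.
Proof. by apply: big1 => i _; rewrite -mpolyC1 mderivC mulr0. Qed.

Lemma der_appM t p q : der_app t (p * q) = der_app t p * q + p * der_app t q.
Proof.
rewrite /der_app mulr_suml mulr_sumr -big_split; apply: eq_bigr => i _.
by rewrite mderivM mulrDr; congr (_ + _); [exact: mulrA | exact: mulrCA].
Qed.

Lemma der_appZ t c p : der_app t (c *: p) = c *: der_app t p.
Proof.
rewrite /der_app scaler_sumr; apply: eq_bigr => i _.
by rewrite mderivZ -scalerAr.
Qed.

Lemma der_app_scale g t p : der_app (der_scale g t) p = g * der_app t p.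
Proof.
by rewrite /der_app mulr_sumr; apply: eq_bigr => i _; rewrite ffunE mulrA.
Qed.

Lemma der_appB t1 t2 p : der_app (t1 - t2) p = der_app t1 p - der_app t2 p.
Proof.
rewrite /der_app -sumrB; apply: eq_bigr => i _.
by rewrite !ffunE mulrBl.
Qed.

Lemma mderiv_lform i (c : 'I_n -> K) : (lform c)^`M(i) = (c i)%:MP.
Proof.
have subUU : (U_(i) - U_(i) = 0 :> 'X_{1..n})%MM.
  by apply/mnmP => j; rewrite mnmBE mnm0E subnn.
rewrite raddf_sum (bigD1 i) //= big1 => [|j ne_ji].
  by rewrite mderivZ mderivX mnm1E eqxx subUU mpolyX0 scale1r addr0 alg_mpolyC.
by rewrite mderivZ mderivX mnm1E (negPf ne_ji) scale0r scaler0.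
Qed.

Lemma der_app_lform t c : der_app t (lform c) = \sum_i c i *: t i.
Proof.
by apply: eq_bigr => i _; rewrite mderiv_lform mulrC mul_mpolyC.
Qed.

Lemma der_app_euler_lform c : der_app euler (lform c) = lform c.
Proof.
by rewrite der_app_lform; apply: eq_bigr => i _; rewrite ffunE.
Qed.

Lemma der_app_lform_homog e t c : der_homog e t ->
  der_app t (lform c) \is e.-homog.
Proof.
by move=> ht; rewrite der_app_lform; apply: rpred_sum => i _; apply/rpredZ/ht.
Qed.

(** In at least one variable this is homogeneity of degree [e - 1], where only
    [0] has degree [-1]; multiplying by linear forms avoids the truncated
    subtraction at [e = 0]. *)
Definition deg_pred e g := forall x : {mpoly K[n]}, x \is 1.-homog ->
  g * x \is e.-homog.

(** The quotient of a homogeneous polynomial by a linear form may be replaced by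
    its component of the expected degree. *)
Lemma homog_quotient e t c : der_homog e t -> log_der t (lform c) ->
  exists2 g, der_app t (lform c) = g * lform c & deg_pred e g.
Proof.
move=> ht [g Dg]; have hom := der_app_lform_homog c ht.
have := pihomog_dE hom; rewrite {1}Dg; case: e {ht} hom => [|e] hom.
  rewrite pihomog0_mul_linear ?lform_homog // => <-.
  by exists 0 => [|x _]; rewrite mul0r // rpred0.
rewrite pihomog_mul_linear ?lform_homog // => <-.
exists (pihomog mdeg e g) => // x hx; rewrite -addn1.
exact: dhomogM (pihomogP _ _ _) hx.
Qed.

Lemma log_der_scale g t p : log_der t p -> log_der (der_scale g t) p.
Proof. by case=> h Dh; exists (g * h); rewrite der_app_scale Dh mulrA. Qed.

Lemma log_der_scale_self t p : log_der (der_scale p t) p.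
Proof. by exists (der_app t p); rewrite der_app_scale mulrC. Qed.

Lemma log_derZ t c p : log_der t p -> log_der t (c *: p).
Proof. by case=> g Dg; exists g; rewrite der_appZ Dg scalerAr. Qed.

Section FormFamily.

Variables (I : eqType) (a : I -> 'I_n -> K) (s : seq I).

Definition form_prod := \prod_(L <- s) lform (a L).

Lemma der_app_euler_prod :
  der_app euler form_prod = (size s)%:R *: form_prod.
Proof.
rewrite /form_prod; elim: s => [|L u IHu].
  by rewrite big_nil der_app1 scale0r.
rewrite big_cons der_appM der_app_euler_lform IHu -scalerAr /=.
by rewrite -[(size u).+1]add1n natrD scalerDl scale1r.
Qed.

Lemma der_app_log_prod e t : der_homog e t ->
  (forall L, L \in s -> log_der t (lform (a L))) ->
  exists2 g, der_app t form_prod = g * form_prod & deg_pred e g.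
Proof.
rewrite /form_prod => ht; elim: s => [|L u IHu] lg.
  exists 0; first by rewrite big_nil der_app1 mul0r.
  by move=> x _; rewrite mul0r rpred0.
have [|h Dh hh] := IHu.
  by move=> M uM; apply: lg; rewrite inE uM orbT.
have [|g Dg hg] := homog_quotient ht (lg L _); first by rewrite inE eqxx.
exists (g + h); last by move=> x hx; rewrite mulrDl rpredD ?hg ?hh.
by rewrite big_cons der_appM Dg Dh mulrDl -!mulrA [_ * (h * _)]mulrCA.
Qed.

Hypothesis charK0 : [pchar K] =i pred0.

(** By the product rule [t Q = g Q] for the product [Q] of the forms, whereas the
    Euler derivation [E] satisfies [E Q = d Q] with [d] the number of forms.
    So [t - (g / d) E] kills [Q], and it is nonzero unless [t] is [(g / d) E]. *)
Lemma annihilating_of_log e t : (0 < size s)%N -> der_homog e t ->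
  (forall L, L \in s -> log_der t (lform (a L))) -> ~ euler_multiple t ->
  exists t', [/\ der_app t' form_prod = 0, der_homog e t' & t' != 0].
Proof.
move=> s_gt0 ht lg nE; have [g Dg hg] := der_app_log_prod ht lg.
have d0 : (size s)%:R != 0 :> K by rewrite ((pcharf0P K).1 charK0) -lt0n.
pose f := (size s)%:R^-1 *: g; exists (t - der_scale f euler); split.
- rewrite der_appB der_app_scale der_app_euler_prod Dg.
  by rewrite -scalerAl -scalerAr scalerA mulVf // scale1r subrr.
- move=> i; rewrite !ffunE rpredB // -scalerAl rpredZ // hg //.
  by rewrite dhomogX /= mdeg1.
- by apply/eqP => /eqP; rewrite subr_eq0 => /eqP Dt; apply: nE; exists f.
Qed.

Hypothesis a_nonzero : forall L, L \in s -> exists v, \sum_i a L i * v i = 1.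

Lemma form_prod_neq0 : form_prod != 0.
Proof.
rewrite prodf_seq_neq0; apply/allP => L sL /=.
by have [v av1] := a_nonzero sL; apply: lform_neq0 av1.
Qed.

Lemma annihilating_not_euler t : (0 < size s)%N ->
  der_app t form_prod = 0 -> t != 0 -> ~ euler_multiple t.
Proof.
move=> s_gt0 kill /eqP t0 [f Dt]; apply: t0; rewrite Dt.
move: kill; rewrite Dt der_app_scale der_app_euler_prod => /eqP.
have d0 : (size s)%:R != 0 :> K by rewrite ((pcharf0P K).1 charK0) -lt0n.
rewrite mulf_eq0 scaler_eq0 (negPf d0) (negPf form_prod_neq0) !orbF => /eqP->.
by apply/ffunP => i; rewrite !ffunE mul0r.
Qed.

Hypothesis s_uniq : uniq s.
Hypothesis a_coprime : forall L M, L \in s -> M \in s ->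
  divides (lform (a L)) (lform (a M)) -> L = M.

(** Write [Q = alpha R].  From [t Q = 0], the form [alpha] divides
    [t(alpha) R]; it is prime and divides no factor of [R]. *)
Lemma log_of_annihilating t L : L \in s -> der_app t form_prod = 0 ->
  log_der t (lform (a L)).
Proof.
move=> sL; have [v av1] := a_nonzero sL.
rewrite /form_prod (bigD1_seq L) //= der_appM => /eqP.
rewrite addr_eq0 => /eqP kill.
have : divides (lform (a L))
   (der_app t (lform (a L)) * \prod_(i <- s | i != L) lform (a i)).
  by rewrite kill; eexists; rewrite mulrC -mulNr.
case/(lform_prime av1) => // div; exfalso; move: div.
rewrite big_seq_cond; apply: (big_ind (fun p => ~ divides (lform (a L)) p)).
- move=> [g /(congr1 (proj_along (a L) v))].
  rewrite rmorph1 rmorphM /= proj_along_lform av1 scale1r subrr mulr0.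
  by move/eqP; rewrite oner_eq0.
- by move=> p q np nq /(lform_prime av1)[].
- by move=> M /andP[sM neq] /(a_coprime sL sM) eqLM; rewrite eqLM eqxx in neq.
Qed.

End FormFamily.

End Derivations.

(** * Restriction of derivations to a hyperplane *)

Section Restriction.

Variables (K : fieldType) (n m : nat) (a v : 'I_n -> K).
Variables (B : 'I_m -> 'I_n -> K) (C : 'I_n -> 'I_m -> K).

(** The rows of [B] are coordinates of a basis of the hyperplane [a = 0]; the rows
    of [C] express in this basis the projections along [v] of the standard basis
    vectors.  So [B] is the matrix of the inclusion of the hyperplane, and [C]
    that of a retraction onto it. *)
Hypothesis av1 : \sum_i a i * v i = 1.
Hypothesis CB : forall i k, \sum_j C i j * B j k = (i == k)%:R - a i * v k.
Hypothesis BC : forall j k, \sum_i B j i * C i k = (j == k)%:R.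

Let res : {mpoly K[n]} -> {mpoly K[m]} :=
  subst (fun i => lform (fun j => B j i)).
Let lift : {mpoly K[m]} -> {mpoly K[n]} :=
  subst (fun j => lform (fun i => C i j)).

HB.instance Definition _ := GRing.RMorphism.on res.
HB.instance Definition _ := GRing.RMorphism.on lift.

Lemma subst_lform_mx (p q : nat) (M : 'I_p -> 'I_q -> K) (c : 'I_p -> K) :
  subst (fun i => lform (M i)) (lform c) =
  lform (fun j => \sum_i c i * M i j).
Proof.
rewrite subst_lform /lform; under eq_bigr do rewrite scaler_sumr.
rewrite exchange_big; apply: eq_bigr => j _; rewrite scaler_suml.
by apply: eq_bigr => i _; rewrite scalerA.
Qed.

Lemma lform_delta (p : nat) (i : 'I_p) (c : 'I_p -> K) :
  (forall k, c k = (i == k)%:R) -> lform c = 'X_i.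
Proof.
move=> Dc; rewrite /lform (bigD1 i) //= Dc eqxx scale1r.
rewrite big1 ?addr0 // => k /negPf ne_ki.
by rewrite Dc eq_sym ne_ki scale0r.
Qed.

Lemma res_lift p : res (lift p) = p.
Proof.
elim/mpoly_gen_ind: p => [c|j|p q IHp IHq|p q IHp IHq].
- by rewrite [lift _]substC [res _]substC.
- rewrite [lift _]substX [res _]subst_lform_mx; apply: lform_delta => k.
  by rewrite eq_sym -BC; apply: eq_bigr => i _; rewrite mulrC.
- by rewrite !rmorphD /= IHp IHq.
- by rewrite !rmorphM /= IHp IHq.
Qed.

Lemma lift_res p : lift (res p) = proj_along a v p.
Proof.
elim/mpoly_gen_ind: p => [c|k|p q IHp IHq|p q IHp IHq].
- by rewrite [res _]substC [lift _]substC [RHS]substC.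
- rewrite [res _]substX [lift _]subst_lform_mx [RHS]substX.
  rewrite -(@lform_delta _ k (fun i => (k == i)%:R)) //.
  rewrite scaler_sumr -sumrB; apply: eq_bigr => i _.
  rewrite scalerA -scalerBl eq_sym [v k * _]mulrC -CB.
  by congr (_ *: _); apply: eq_bigr => j _; rewrite mulrC.
- by rewrite !rmorphD /= IHp IHq.
- by rewrite !rmorphM /= IHp IHq.
Qed.

Lemma res_eq0 p : res p = 0 <-> divides (lform a) p.
Proof.
rewrite (divides_lformP av1) -lift_res; split=> [->|p0].
  by rewrite rmorph0.
by rewrite -(res_lift (res p)) p0 rmorph0.
Qed.

(** The composite of [lift], [t] and [res], written on the coordinates of the
    hyperplane.  It is compatible with [res] when [t] preserves the ideal of the
    hyperplane, see [res_der_lform]. *)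
Definition res_der (t : {ffun 'I_n -> {mpoly K[n]}}) :
    {ffun 'I_m -> {mpoly K[m]}} := [ffun j => \sum_i C i j *: res (t i)].

Lemma subst_homog e p (h : 'I_n -> {mpoly K[m]}) :
  (forall i, h i \is 1.-homog) -> p \is e.-homog -> subst h p \is e.-homog.
Proof.
move=> hh hp; rewrite [p]mpolyE raddf_sum big_seq /=; apply: rpred_sum => u pu.
rewrite substZ rpredZ // -(dhomog_mf hp pu) /subst mmapX /mmap1 /= mdegE.
elim/big_rec2: _ => [|i d q _ hq]; first exact: dhomog1.
by rewrite dhomogM // -[X in X.-homog]mul1n dhomogMn.
Qed.

Lemma res_der_homog e t : der_homog e t -> der_homog e (res_der t).
Proof.
move=> ht j; rewrite ffunE; apply: rpred_sum => i _; apply: rpredZ.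
by apply: subst_homog => // k; apply: lform_homog.
Qed.

(** Lifting the restriction of [c] gives [c - c(v) a], and the
    correction is harmless because [t] maps [a] into the ideal it generates. *)
Lemma res_der_lform t c : log_der t (lform a) ->
  der_app (res_der t) (res (lform c)) = res (der_app t (lform c)).
Proof.
have res_comb d : res (der_app t (lform d)) = \sum_i d i *: res (t i).
  rewrite der_app_lform raddf_sum; apply: eq_bigr => i _.
  by rewrite [LHS]substZ.
move/res_eq0; rewrite !res_comb => ta0.
rewrite [res (lform c)]subst_lform_mx der_app_lform.
under eq_bigr => j _ do rewrite ffunE scaler_sumr.
rewrite exchange_big /=.
transitivity (\sum_i (c i *: res (t i)
   - (\sum_k c k * v k) *: (a i *: res (t i)))).
  apply: eq_bigr => i _; under eq_bigr do rewrite scalerA.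
  rewrite -scaler_suml scalerA -scalerBl; congr (_ *: _).
  under eq_bigr do rewrite mulr_suml.
  rewrite exchange_big /= mulr_suml.
  transitivity (\sum_k c k * ((i == k)%:R - a i * v k)).
    apply: eq_bigr => k _; rewrite -CB mulr_sumr; apply: eq_bigr => j _.
    by rewrite -mulrA [B _ _ * _]mulrC.
  under eq_bigr do rewrite mulrBr.
  rewrite sumrB (bigD1 i) //= eqxx mulr1 big1 ?addr0; last first.
    by move=> k /negPf ne; rewrite eq_sym ne mulr0.
  by congr (_ - _); apply: eq_bigr => k _; rewrite [a i * _]mulrC mulrA.
by rewrite sumrB -scaler_sumr ta0 scaler0 subr0.
Qed.

Lemma log_der_res t c : log_der t (lform a) -> log_der t (lform c) ->
  log_der (res_der t) (res (lform c)).
Proof.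
by move=> lga [g Dg]; exists (res g); rewrite res_der_lform // Dg rmorphM.
Qed.

(** Lift the multiplier [f0] of the Euler derivation of the hyperplane to [f].
    Then [t] and [f E] have the same restriction, so all coordinates of their
    difference vanish on the hyperplane. *)
Lemma res_der_euler t : log_der t (lform a) -> euler_multiple (res_der t) ->
  exists f h, t = der_scale f (euler K n) + der_scale (lform a) h.
Proof.
move=> lga [f0 Df0]; pose f := lift f0; exists f.
have resX i : res (t i) = res (f * 'X_i).
  have Dx : lform (fun k => (i == k)%:R) = 'X_i :> {mpoly K[n]}.
    exact: lform_delta.
  have <- : der_app t (lform (fun k => (i == k)%:R : K)) = t i.
    rewrite der_app_lform (bigD1 i) //= eqxx scale1r big1 ?addr0 //.
    by move=> k; rewrite eq_sym => /negPf->; rewrite scale0r.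
  rewrite -res_der_lform // Df0 der_app_scale Dx rmorphM /= res_lift.
  by rewrite [res 'X_i]substX der_app_euler_lform.
have div i : exists g, t i - f * 'X_i == g * lform a.
  have [|g Dg] := (res_eq0 (t i - f * 'X_i)).1; last by exists g; apply/eqP.
  by rewrite rmorphB /= resX subrr.
exists [ffun i => xchoose (div i)]; apply/ffunP => i; rewrite !ffunE.
by rewrite [_ * xchoose _]mulrC -(eqP (xchooseP (div i))) addrC subrK.
Qed.

End Restriction.

(** Comparing components of degree [e] makes the decomposition homogeneous; in
    degree [0] nothing is left of either summand. *)
Lemma euler_lform_split_homog (K : fieldType) n (a : 'I_n -> K) e t f h :
  der_homog e t -> t = der_scale f (euler K n) + der_scale (lform a) h ->
  t = 0 \/ exists e' f' h', [/\ e = e'.+1, der_homog e' h' &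
    t = der_scale f' (euler K n) + der_scale (lform a) h'].
Proof.
move=> ht Dt.
have hX (i : 'I_n) : 'X_i \is [in K[n], 1.-homog].
  by rewrite dhomogX /= mdeg1.
have Dti i : t i = pihomog mdeg e (f * 'X_i) + pihomog mdeg e (h i * lform a).
  rewrite -{1}(pihomog_dE (ht i)) {1}Dt !ffunE raddfD /=.
  by rewrite [_ * h i]mulrC.
case: e ht Dti => [|e] ht Dti.
  left; apply/ffunP => i; rewrite Dti !ffunE !pihomog0_mul_linear ?addr0 //.
  exact: lform_homog.
right; exists e, (pihomog mdeg e f), [ffun i => pihomog mdeg e (h i)].
split=> // [i|]; first by rewrite ffunE pihomogP.
apply/ffunP => i; rewrite Dti !ffunE !pihomog_mul_linear ?lform_homog //.
by rewrite [lform a * _]mulrC.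
Qed.

(** * Forms of hyperplanes in coordinates *)

Section HyperplaneForms.

Variables (K : fieldType) (V : vectType K).

Lemma lker_defining_form_lker (f : 'Hom(V, K^o)) :
  lker (defining_form (lker f)) = lker f.
Proof.
rewrite /defining_form; case: boolp.pselect => [exf|[]]; last by exists f.
exact/eqP/(xchooseP exf).
Qed.

Lemma formZ (f : 'Hom(V, K^o)) (c : K) x : f (c *: x) = c * (f x : K).
Proof. exact: linearZ. Qed.

Lemma formB (f : 'Hom(V, K^o)) x y : f (x - y) = (f x : K) - (f y : K).
Proof. exact: linearB. Qed.

Lemma lker_sub_proportional (f g : 'Hom(V, K^o)) :
  (lker f <= lker g)%VS -> exists c : K, forall x, g x = c * f x.
Proof.
move=> /subvP fg; have [f0|] := eqVneq (lker f) fullv.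
  exists 0 => x; rewrite mul0r; apply/eqP; rewrite -memv_ker fg //.
  by rewrite f0 memvf.
rewrite eqEsubv subvf /= => /subvPn[v _]; rewrite memv_ker => fv0.
exists (g v / f v) => x; apply/eqP; rewrite -subr_eq0.
have -> : g x - g v / f v * f x = g (x - (f x / f v) *: v).
  by rewrite formB formZ; congr (_ - _); rewrite mulrC mulrCA mulrC.
rewrite -memv_ker; apply: fg; rewrite memv_ker formB formZ.
by rewrite mulfVK ?subrr.
Qed.

End HyperplaneForms.

Definition form_coef (K : fieldType) (V : vectType K) n (b : n.-tuple V)
    (L : {vspace V}) (i : 'I_n) : K :=
  defining_form L (tnth b i).

Section Coordinates.

Variables (K : fieldType) (l : nat).
Local Notation V := 'rV[K]_l.
Local Notation coef := (form_coef (std_basis K l)).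

Lemma form_coef_std (L : {vspace V}) i :
  coef L i = defining_form L (delta_mx 0 i).
Proof. by rewrite /form_coef tnth_map tnth_ord_tuple. Qed.

Lemma form_coefE (L : {vspace V}) (x : V) :
  defining_form L x = \sum_i coef L i * x 0 i.
Proof.
rewrite {1}[x]row_sum_delta linear_sum; apply: eq_bigr => i _.
by rewrite linearZ mulrC form_coef_std.
Qed.

Lemma mem_defining_form (L : {vspace V}) (x : V) : (\dim L).+1 = \dim {:V} ->
  (x \in L) = (defining_form L x == 0).
Proof. by move=> dimL; rewrite -memv_ker lker_defining_form. Qed.

Lemma form_coef_witness (L : {vspace V}) : (\dim L).+1 = \dim {:V} ->
  exists v : V, defining_form L v = 1.
Proof.
move=> dimL; have : ~~ ({:V} <= L)%VS.
  by apply/negP => /dimvS; rewrite -dimL ltnn.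
rewrite -{1}(lker_defining_form dimL) => /subvPn[v _].
rewrite memv_ker => fv0; exists ((defining_form L v)^-1 *: v).
by rewrite formZ mulVf.
Qed.

Lemma form_coef_neq0 (L : {vspace V}) : (\dim L).+1 = \dim {:V} ->
  exists v, \sum_i coef L i * v i = 1.
Proof.
by case/form_coef_witness=> v Lv1; exists (v 0); rewrite -form_coefE.
Qed.

(** If the form of [L] divides that of [M], the latter vanishes on [L]; evaluating
    at points turns divisibility into an inclusion of hyperplanes, which is an
    equality by dimension. *)
Lemma form_coef_coprime (L M : {vspace V}) :
  (\dim L).+1 = \dim {:V} -> (\dim M).+1 = \dim {:V} ->
  divides (lform (coef L)) (lform (coef M)) -> L = M.
Proof.
move=> dimL dimM [g Dg]; apply/eqP; rewrite eqEdim.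
rewrite -ltnS dimM dimL leqnn andbT; apply/subvP => x.
rewrite (mem_defining_form _ dimL) (mem_defining_form _ dimM) !form_coefE.
by rewrite -!lform_meval Dg mevalM => /eqP->; rewrite mulr0.
Qed.

Definition basis_coord (H : {vspace V}) m (b : m.-tuple (subvs_of H))
    (j : 'I_m) (i : 'I_l) : K :=
  vsval (tnth b j) 0 i.

Lemma hyperplane_coords (H : {vspace V}) m (b : m.-tuple (subvs_of H)) (v : V) :
  basis_of {:subvs_of H} b -> (\dim H).+1 = \dim {:V} ->
  defining_form H v = 1 ->
  let B := basis_coord b in
  exists C : 'I_l -> 'I_m -> K,
  (forall i k, \sum_j C i j * B j k = (i == k)%:R - coef H i * v 0 k) /\
  (forall j k, \sum_i B j i * C i k = (j == k)%:R).
Proof.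
move=> b_basis dimH Hv1 B.
pose pr i : V := delta_mx 0 i - coef H i *: v.
have prH i : pr i \in H.
  rewrite (mem_defining_form _ dimH) formB formZ Hv1.
  by rewrite mulr1 form_coef_std subrr.
have Bform j : \sum_i B j i * coef H i = 0.
  under eq_bigr do rewrite mulrC.
  rewrite -form_coefE; apply/eqP; move: (subvsP (tnth b j)).
  by rewrite (mem_defining_form _ dimH).
exists (fun i j => coord b j (vsproj H (pr i))); split=> [i k|j k].
  have Dpr : pr i = \sum_j coord b j (vsproj H (pr i)) *: vsval (tnth b j).
    rewrite -[LHS](vsprojK (prH i)).
    rewrite [X in vsval X](coord_basis b_basis (memvf _)) linear_sum.
    by apply: eq_bigr => j _; rewrite linearZ /= (tnth_nth 0).
  transitivity (pr i 0 k); last by rewrite !mxE eqxx eq_sym.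
  by rewrite [in RHS]Dpr summxE; apply: eq_bigr => j _; rewrite mxE.
transitivity (coord b k (tnth b j)); last first.
  by rewrite (tnth_nth 0) coord_free // (basis_free b_basis).
have -> : tnth b j = vsproj H (\sum_i B j i *: pr i).
  rewrite -[LHS]vsvalK; congr (vsproj H _).
  under eq_bigr do rewrite scalerBr scalerA.
  by rewrite sumrB -scaler_suml Bform scale0r subr0 -row_sum_delta.
by rewrite !linear_sum; apply: eq_bigr => i _; rewrite !linearZ.
Qed.

(** The chosen form of a restricted hyperplane need not be the restriction of the
    chosen form, but both have the same kernel. *)
Lemma defining_form_restriction (H L : {vspace V}) :
  (\dim L).+1 = \dim {:V} ->
  exists c : K, forall x : subvs_of H,
  defining_form (linfun (@vsval K V H) @^-1: L)%VS x =
    c * defining_form L (vsval x).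
Proof.
move=> dimL; set iota := linfun _.
pose f := (defining_form L \o iota)%VF.
have kerE : (iota @^-1: L)%VS = lker f.
  apply/vspaceP => x.
  by rewrite memv_ker comp_lfunE -memv_ker lker_defining_form // memv_preim.
have [c Dc] : exists c : K, forall x, defining_form (lker f) x = c * f x.
  by apply: lker_sub_proportional; rewrite lker_defining_form_lker.
by exists c => x; rewrite kerE Dc comp_lfunE lfunE.
Qed.

End Coordinates.

(** * The three comparisons of minimal degrees *)

Definition log_arrangement (K : fieldType) (V : vectType K) n (b : n.-tuple V)
    (A : {fset {vspace V}}) (t : {ffun 'I_n -> {mpoly K[n]}}) :=
  forall L, L \in A -> log_der t (lform (form_coef b L)).

Definition has_D0 (K : fieldType) (V : vectType K) n (b : n.-tuple V)
    (A : {fset {vspace V}}) (e : nat) :=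
  exists t, [/\ in_D0 b A t, der_homog e t & t != 0].

Lemma min_deg_D0E (K : fieldType) (V : vectType K) n (b : n.-tuple V)
    (A : {fset {vspace V}}) :
  min_deg_D0 b A = xnat_min (has_D0 b A).
Proof. by []. Qed.

Lemma size_fset_gt0 (T : choiceType) (A : {fset T}) x :
  x \in A -> (0 < size A)%N.
Proof. by move=> Ax; rewrite cardfs_gt0; apply/fset0Pn; exists x. Qed.

Lemma essential_neq0 (K : fieldType) (V : vectType K) (A : {fset {vspace V}}) :
  (0 < \dim {:V})%N -> essential A -> exists L, L \in A.
Proof.
move=> dimV essA; apply/fset0Pn/eqP => A0; move: essA dimV.
by rewrite /essential A0 big_nil => ->; rewrite dimv0.
Qed.

Section Criterion.

Variables (K : fieldType) (charK0 : [pchar K] =i pred0).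

Lemma has_D0_of_log (V : vectType K) n (b : n.-tuple V)
    (A : {fset {vspace V}}) L e t :
  L \in A -> der_homog e t -> log_arrangement b A t -> ~ euler_multiple t ->
  has_D0 b A e.
Proof. by move=> /size_fset_gt0; apply: annihilating_of_log. Qed.

Variables (l : nat) (A : {fset {vspace 'rV[K]_l}}) (arrA : is_arrangement A).
Local Notation std := (std_basis K l).

Lemma in_D0_log t : in_D0 std A t -> log_arrangement std A t.
Proof.
move=> D0t L AL; apply: (log_of_annihilating _ (fset_uniq A) _ AL D0t).
  by move=> M AM; apply/form_coef_neq0/arrA.
by move=> M N AM AN; apply: form_coef_coprime; apply: arrA.
Qed.

Lemma in_D0_not_euler L t : L \in A ->
  in_D0 std A t -> t != 0 -> ~ euler_multiple t.
Proof.
move=> AL; apply: (annihilating_not_euler charK0) (size_fset_gt0 AL).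
by move=> M AM; apply/form_coef_neq0/arrA.
Qed.

End Criterion.

Section AddHyperplane.

Variables (K : fieldType) (charK0 : [pchar K] =i pred0) (l : nat).
Variables (A : {fset {vspace 'rV[K]_l}}) (arrA : is_arrangement A).
Variables (H L0 : {vspace 'rV[K]_l}) (HA : H \in A).
Local Notation A' := (A `\ H)%fset.
Hypothesis A'L0 : L0 \in A'.
Local Notation std := (std_basis K l).
Local Notation alpha := (lform (form_coef std H)).

Lemma mem_deleted L : L \in A' -> L \in A.
Proof. by rewrite in_fsetD1 => /andP[]. Qed.

Lemma is_arrangement_deleted : is_arrangement A'.
Proof. by move=> L /mem_deleted; apply: arrA. Qed.

Lemma alpha_neq0 : alpha != 0.
Proof. by have [v /lform_neq0] := form_coef_neq0 (arrA HA). Qed.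

Lemma has_D0_delete e : has_D0 std A e -> has_D0 std A' e.
Proof.
case=> t [D0t ht t0]; apply: (has_D0_of_log charK0 A'L0 ht).
  by move=> L /mem_deleted; apply: in_D0_log.
exact: (in_D0_not_euler charK0 arrA HA D0t t0).
Qed.

Lemma has_D0_succ e : has_D0 std A' e -> has_D0 std A e.+1.
Proof.
case=> t [D0t ht t0]; apply: (has_D0_of_log charK0 HA (t := der_scale alpha t)).
- move=> i; rewrite ffunE; apply: (@dhomogM _ _ _ 1%N) => //.
  exact: lform_homog.
- move=> L AL; have [->|neLH] := eqVneq L H; first exact: log_der_scale_self.
  apply/log_der_scale/(in_D0_log is_arrangement_deleted D0t).
  by rewrite in_fsetD1 neLH.
(* Every multiple of [t] kills the defining polynomial of [A'], and no nonzero
   multiple of the Euler derivation does. *)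
apply: (in_D0_not_euler charK0 is_arrangement_deleted A'L0).
  by rewrite /in_D0 der_app_scale [der_app t _]D0t mulr0.
apply: contraNneq t0 => at0; apply/eqP/ffunP => i; apply/eqP.
move/ffunP/(_ i)/eqP: at0; rewrite !ffunE mulf_eq0.
by rewrite (negPf alpha_neq0).
Qed.

(** Since [t] and the Euler derivation are logarithmic for [A'], so is [alpha h];
    the factor [alpha] can be dropped because the other forms are prime to it. *)
Lemma log_arrangement_cofactor t f h : log_arrangement std A t ->
  t = der_scale f (euler K l) + der_scale alpha h -> log_arrangement std A' h.
Proof.
move=> lgt Dt L A'L; have AL := mem_deleted A'L.
have [w Lw1] := form_coef_neq0 (arrA AL); have [g Dg] := lgt L AL.
have : divides (lform (form_coef std L))
    (alpha * der_app h (lform (form_coef std L))).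
  exists (g - f); rewrite mulrBl -Dg Dt -der_app_scale.
  rewrite -[X in _ = _ - f * X]der_app_euler_lform -der_app_scale -der_appB.
  by rewrite addrC addKr.
case/(lform_prime Lw1) => // /(form_coef_coprime (arrA AL) (arrA HA)) eqLH.
by move: A'L; rewrite eqLH in_fsetD1 eqxx.
Qed.

Variables (m : nat) (b : m.-tuple (subvs_of H)).
Hypothesis b_basis : basis_of {:subvs_of H} b.

Lemma form_coef_restriction L : L \in A -> exists c,
  lform (form_coef b (linfun (@vsval K _ H) @^-1: L)%VS) =
  c *: subst (fun i => lform (fun j => basis_coord b j i))
         (lform (form_coef std L)).
Proof.
move=> AL; have [c Dc] := defining_form_restriction H (arrA AL).
exists c; rewrite subst_lform_mx /lform scaler_sumr; apply: eq_bigr => j _.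
by rewrite scalerA [form_coef b _ _]Dc form_coefE; congr (_ * _ *: _).
Qed.

(** An element [t] of [D_0(A)] whose restriction to [H] is a multiple of the Euler
    derivation is [f E + alpha h]; the cofactor [h] has degree one less, and is
    not a multiple [g E], as [t] would then be [(f + alpha g) E]. *)
Lemma has_D0_descent e : ~ has_D0 b (restriction A H) e ->
  has_D0 std A e -> exists2 d, e = d.+1 & has_D0 std A' d.
Proof.
move=> nD0'' [t [D0t ht t0]].
have lgt := in_D0_log arrA D0t.
have nE := in_D0_not_euler charK0 arrA HA D0t t0.
have [v Hv1] := form_coef_witness (arrA HA).
have av1 : \sum_i form_coef std H i * v 0 i = 1 by rewrite -form_coefE.
have [C [CB BC]] := hyperplane_coords b_basis (arrA HA) Hv1.
have [|f [h Dt]] := res_der_euler av1 CB BC (lgt H HA).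
  apply: boolp.contrapT => nE''; apply: nD0''.
  have rL0 : (linfun (@vsval K _ H) @^-1: L0)%VS \in restriction A H.
    exact: in_imfset.
  apply: (has_D0_of_log charK0 rL0 (res_der_homog _ C ht) _ nE'').
  move=> M /imfsetP[/= L A'L ->]; have AL := mem_deleted A'L.
  have [c ->] := form_coef_restriction AL.
  exact/log_derZ/(log_der_res av1 CB BC (lgt H HA))/lgt.
have [Dt0|[d [f' [h' [-> hh' Dt']]]]] := euler_lform_split_homog ht Dt.
  by rewrite Dt0 eqxx in t0.
exists d => //; apply: (has_D0_of_log charK0 A'L0 hh').
  exact: log_arrangement_cofactor lgt Dt'.
move=> [g Dg]; apply: nE; exists (f' + alpha * g); rewrite Dt' Dg.
by apply/ffunP => i; rewrite !ffunE mulrA mulrDl.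
Qed.

End AddHyperplane.

Local Open Scope fset_scope.

Theorem theorem2p14 (K : fieldType) (charK0 : [pchar K] =i pred0)
    (l : nat) (l_ge2 : (2 <= l)%N)
    (A : {fset {vspace 'rV[K]_l}}) (arrA : is_arrangement A)
    (H : {vspace 'rV[K]_l}) (HA : H \in A)
    (essA : essential A) (essA' : essential (A `\ H))
    (b : (l.-1).-tuple (subvs_of H)) (b_basis : basis_of {:subvs_of H} b) :
  let r := min_deg_D0 (std_basis K l) A in
  let r' := min_deg_D0 (std_basis K l) (A `\ H) in
  let r'' := min_deg_D0 b (restriction A H) in
  xnat_lt r' r'' -> r = xnat_succ r'.
Proof.
move=> r r' r''; rewrite {}/r {}/r''; case Dr': r' => [e|//] lt_er''.
move: Dr'; rewrite /r' !min_deg_D0E => /xnat_minP[D0'e min_e].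
have [L0 A'L0] : exists L, L \in A `\ H.
  by apply: essential_neq0 essA'; rewrite dimvf /dim /= mul1n ltnW.
have nD0'' : ~ has_D0 b (restriction A H) e.
  move=> D0''e; move: lt_er''; rewrite min_deg_D0E.
  case Dr'': (xnat_min _) => [d|] /=; move/xnat_minP: Dr''.
    by move=> [_ /(_ _ D0''e)]; rewrite leqNgt => /negP.
  by move/(_ _ D0''e).
apply/xnat_minP; split; first exact: (has_D0_succ charK0 arrA HA A'L0).
move=> k D0k; rewrite ltn_neqAle.
rewrite (min_e _ (has_D0_delete charK0 arrA HA A'L0 D0k)) andbT.
(* A nonzero element of [D_0(A)] in degree [r'] would descend to one of [D_0(A')]
   in degree [r' - 1]. *)
apply/eqP => Dk; rewrite -{}Dk in D0k.
have [d De D0'd] := has_D0_descent charK0 arrA HA A'L0 b_basis nD0'' D0k.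
by have := min_e d D0'd; rewrite De ltnn.
Qed.
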